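(* Let $p$ be a prime and let $\lambda = (\lambda_1,\ldots,\lambda_{l(\lambda)})$ be a partition of $n$. Then $\lambda \in \mathcal{C}^1_p$ (that is, $p$ divides $|H^1(\Sigma_n,S^\lambda_{\mathbb{Z}})|$) if and only if $\lambda \ne (n)$ and $\lambda_i \equiv -1 \pmod{p^{z_i}}$ for all $1 \le i \le l(\lambda)$, where $z_i := \min\{r \in \mathbb{Z}_{\ge 0} \mid p^r > \lambda_{i+1}\}$.
   Context: $\Sigma_n$ is the symmetric group on $n$ letters. $S^\lambda_{\mathbb{Z}}$ is the integral Specht module in James' convention (the $\mathbb{Z}\Sigma_n$-submodule of the permutation module on $\lambda$-tabloids spanned by polytabloids, so $S^{(n)}_{\mathbb{Z}}$ is trivial). $l(\lambda)$ is the number of nonzero parts of $\lambda$, and $\lambda_{l(\lambda)+1} := 0$ (so $z_{l(\lambda)} = 0$). $\mathcal{C}^1_p := \bigcup_{n \in \mathbb{Z}_{\ge 0}} \{\lambda \vdash n \mid p \text{ divides } |H^1(\Sigma_n,S^\lambda_{\mathbb{Z}})|\}$, where $H^1(\Sigma_n,S^\lambda_{\mathbb{Z}})$ is a finite group. *)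

(* Defs.v *)
From HB Require Import structures.
From mathcomp Require Import all_boot all_order all_algebra all_fingroup.
From mathcomp Require Import ring_quotient.
From mathcomp Require Import boolp classical_sets functions cardinality.

Set Implicit Arguments.
Unset Strict Implicit.
Unset Printing Implicit Defensive.

Import GRing.Theory.

Local Open Scope ring_scope.

(* H^1(G, M) = Z^1(G, M) / B^1(G, M) for a finite group G and a right
   ZG-module M. Permutations are composed from left to right in 'S_n, so
   that right modules are the natural ones (as in James' book); the map
   f |-> (g |-> f g^-1) identifies this H^1 with that of the left module
   g . m := m . g^-1. *)

Record gmodule (gT : finGroupType) := GModule {
  gcarrier :> zmodType;
  gact : {action gT &-> gcarrier};
  gactD : forall g, {morph gact^~ g : u v / u + v}
}.

Section H1.
Variables (gT : finGroupType) (M : gmodule gT).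

Definition is_cocycle1 : {pred {ffun gT -> M}} :=
  [pred f : {ffun gT -> M} |
     [forall g, forall h, f (g * h)%g == gact M (f g) h + f h]].

Lemma cocycle1P (f : {ffun gT -> M}) :
  reflect (forall g h, f (g * h)%g = gact M (f g) h + f h)
          (f \in is_cocycle1).
Proof.
apply: (iffP forallP) => [H g h | H g]; first by have /forallP/(_ h)/eqP := H g.
by apply/forallP => h; rewrite H.
Qed.

Lemma gact0 g : gact M 0 g = 0.
Proof. by apply: (@addIr _ (gact M 0 g)); rewrite -gactD !add0r. Qed.

Lemma gactN g m : gact M (- m) g = - gact M m g.
Proof. by apply: (addIr (gact M m g)); rewrite -gactD !addNr gact0. Qed.

Lemma cocycle1_zmod_closed : zmod_closed is_cocycle1.
Proof.
split=> [|f f' /cocycle1P Hf /cocycle1P Hf'].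
  by apply/cocycle1P => g h; rewrite !ffunE gact0 addr0.
apply/cocycle1P => g h; rewrite !ffunE Hf Hf' gactD gactN opprD.
by rewrite addrACA.
Qed.

HB.instance Definition _ :=
  GRing.isZmodClosed.Build {ffun gT -> M} is_cocycle1 cocycle1_zmod_closed.

Definition cocycle1 := {f : {ffun gT -> M} | f \in is_cocycle1}.
HB.instance Definition _ := SubChoice.on cocycle1.
HB.instance Definition _ := [SubChoice_isSubZmodule of cocycle1 by <:].

Definition is_coboundary1 : {pred cocycle1} :=
  [pred f : cocycle1 |
     `[< exists m : M, forall g, val f g = gact M m g - m >]].

Lemma coboundary1P (f : cocycle1) :
  reflect (exists m : M, forall g, val f g = gact M m g - m)
          (f \in is_coboundary1).
Proof. exact: asboolP. Qed.

Lemma coboundary1_zmod_closed : zmod_closed is_coboundary1.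
Proof.
split=> [|f f' /coboundary1P[m Hm] /coboundary1P[m' Hm']]; apply/coboundary1P.
  by exists 0 => g; rewrite GRing.val0 ffunE gact0 subr0.
exists (m - m') => g.
by rewrite GRing.valB !ffunE Hm Hm' gactD gactN !opprD addrACA.
Qed.

HB.instance Definition _ :=
  GRing.isZmodClosed.Build cocycle1 is_coboundary1 coboundary1_zmod_closed.

Definition H1 : zmodType := Quotient.quot is_coboundary1.

End H1.

Definition is_partition (n : nat) (la : seq nat) : bool :=
  [&& sorted geq la, 0%N \notin la & sumn la == n].

(* The partition (n), which is the empty one for n = 0. *)
Definition one_row (n : nat) : seq nat := if n is 0 then [::] else [:: n].

Section Specht.
Variables (n : nat) (la : seq nat).

Definition box := {i : 'I_(size la) & 'I_(nth 0 la i)}.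
HB.instance Definition _ := Finite.on box.

(* A tableau t is encoded by the map sending each entry to the box of the
   Young diagram that contains it; each box contains exactly one entry. *)
Definition tableau :=
  {t : {ffun 'I_n -> box} | [forall b, #|[set k | t k == b]| == 1%N]}.
HB.instance Definition _ := Finite.on tableau.

(* A tabloid, i.e. a tableau with unordered row entries, is encoded by the map
   sending each entry to its row. *)
Definition tabloid :=
  {T : {ffun 'I_n -> 'I_(size la)} |
     [forall i, #|[set k | T k == i]| == nth 0%N la i]}.
HB.instance Definition _ := Finite.on tabloid.

Definition row (t : tableau) (k : 'I_n) : 'I_(size la) := tag (val t k).
Definition col (t : tableau) (k : 'I_n) : nat := tagged (val t k).

Lemma tabloid_of_subproof (t : tableau) :
  [forall i, #|[set k | [ffun k => row t k] k == i]| == nth 0%N la i].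
Proof.
apply/forallP => i; apply/eqP; rewrite -sum1dep_card.
rewrite (eq_bigl (fun k => tag (val t k) == i)) => [|k]; last by rewrite ffunE.
rewrite (partition_big (fun k => val t k) (fun b : box => tag b == i)) //=.
rewrite (eq_bigr (fun=> 1%N)) => [|b bi].
  rewrite (eq_bigl (fun b : box => pred1 i (tag b) && true)) => [|b]; last first.
    by rewrite andbT.
  rewrite -(@sig_big_dep _ _ _ _ (fun i : 'I_(size la) => 'I_(nth 0%N la i))
              (pred1 i) (fun _ _ => true) (fun _ _ => 1%N)) /=.
  by rewrite big_pred1_eq sum1_card card_ord.
have /eqP tb := forallP (valP t) b; rewrite -[RHS]tb -sum1dep_card.
by apply: eq_bigl => k; case: (val t k =P b) => [->|_]; rewrite ?bi ?andbF.
Qed.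

Definition tabloid_of (t : tableau) : tabloid :=
  Sub [ffun k => row t k] (tabloid_of_subproof t).

Lemma act_subproof (B : finType) (f : {ffun 'I_n -> B}) (s : 'S_n)
    (c : B -> nat) :
  [forall b, #|[set k | f k == b]| == c b] ->
  [forall b, #|[set k | [ffun k => f ((s^-1)%g k)] k == b]| == c b].
Proof.
move=> /forallP H; apply/forallP => b; rewrite -(eqP (H b)); apply/eqP.
rewrite -(card_imset [set k | f k == b] (@perm_inj _ s)).
apply: eq_card => k; rewrite !inE ffunE.
apply/eqP/imsetP => [<- | [j]]; first by exists ((s^-1)%g k); rewrite ?inE ?permKV.
by rewrite inE => /eqP <- ->; rewrite permK.
Qed.

(* t s is obtained from t by replacing each entry k with s k. *)
Definition tableau_act (t : tableau) (s : 'S_n) : tableau :=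
  Sub [ffun k => val t ((s^-1)%g k)]
      (@act_subproof _ (val t) s (fun=> 1%N) (valP t)).

Definition tabloid_act (T : tabloid) (s : 'S_n) : tabloid :=
  Sub [ffun k => val T ((s^-1)%g k)]
      (@act_subproof _ (val T) s (fun i => nth 0%N la i) (valP T)).

Lemma tabloid_act1 T : tabloid_act T 1 = T.
Proof.
by apply: val_inj; apply/ffunP => k; rewrite /= ffunE invg1 perm1.
Qed.

Lemma tabloid_actM T s u :
  tabloid_act T (s * u)%g = tabloid_act (tabloid_act T s) u.
Proof.
by apply: val_inj; apply/ffunP => k; rewrite /= !ffunE invMg permM.
Qed.

Lemma tabloid_of_act t s :
  tabloid_of (tableau_act t s) = tabloid_act (tabloid_of t) s.
Proof. by apply: val_inj; apply/ffunP => k; rewrite /= !ffunE /row /= ffunE. Qed.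

(* The permutation module: integral combinations of tabloids. *)
Definition permmod := {ffun tabloid -> int}.
HB.instance Definition _ := GRing.Zmodule.on permmod.

Definition basis (T : tabloid) : permmod := [ffun T' => (T' == T)%:Z].

Definition permmod_act (x : permmod) (s : 'S_n) : permmod :=
  [ffun T => x (tabloid_act T s^-1)].

Lemma permmod_act_basis T s :
  permmod_act (basis T) s = basis (tabloid_act T s).
Proof.
apply/ffunP => T'; rewrite !ffunE; congr (nat_of_bool _)%:Z.
by apply/eqP/eqP => [<- | ->]; rewrite -tabloid_actM ?mulVg ?mulgV tabloid_act1.
Qed.

Lemma permmod_act1 x : permmod_act x 1 = x.
Proof. by apply/ffunP => T; rewrite ffunE invg1 tabloid_act1. Qed.

Lemma permmod_actM x s u :
  permmod_act x (s * u)%g = permmod_act (permmod_act x s) u.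
Proof. by apply/ffunP => T; rewrite !ffunE invMg tabloid_actM. Qed.

Definition permmod_actr (s : 'S_n) (x : permmod) : permmod := permmod_act x s.

Lemma permmod_actr_is_zmod_morphism s : zmod_morphism (permmod_actr s).
Proof. by move=> x y; apply/ffunP => T; rewrite !ffunE. Qed.

HB.instance Definition _ s :=
  GRing.isZmodMorphism.Build permmod permmod (permmod_actr s)
    (permmod_actr_is_zmod_morphism s).

Definition colstab (t : tableau) : {set 'S_n} :=
  [set s : 'S_n | [forall k, col t (s k) == col t k]].

Definition polytabloid (t : tableau) : permmod :=
  \sum_(s in colstab t) basis (tabloid_act (tabloid_of t) s) *~ (-1) ^+ s.

Definition in_specht : {pred permmod} :=
  [pred x : permmod | `[< exists c : tableau -> int,
                            x = \sum_(t : tableau) polytabloid t *~ c t >]].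

Lemma in_spechtP (x : permmod) :
  reflect (exists c : tableau -> int,
             x = \sum_(t : tableau) polytabloid t *~ c t)
          (x \in in_specht).
Proof. exact: asboolP. Qed.

Lemma in_specht_zmod_closed : zmod_closed in_specht.
Proof.
split=> [|x y /in_spechtP[c ->] /in_spechtP[d ->]]; apply/in_spechtP.
  by exists (fun=> 0); rewrite big1.
exists (fun t => c t - d t).
by rewrite -sumrB; apply: eq_bigr => t _; rewrite mulrzBr.
Qed.

HB.instance Definition _ :=
  GRing.isZmodClosed.Build permmod in_specht in_specht_zmod_closed.

Definition specht_type := {x : permmod | x \in in_specht}.
HB.instance Definition _ := SubChoice.on specht_type.
HB.instance Definition _ := [SubChoice_isSubZmodule of specht_type by <:].

Lemma polytabloid_act t s :
  permmod_act (polytabloid t) s = polytabloid (tableau_act t s).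
Proof.
rewrite -[LHS]/(permmod_actr s _) /polytabloid raddf_sum.
rewrite [RHS](reindex_inj (conjg_inj s)) /=; apply: eq_big => u.
  rewrite !inE; apply/forallP/forallP => H k.
    have := H ((s^-1)%g k); rewrite /col /= !ffunE conjgE !permM permK.
    by [].
  have := H (s k); rewrite /col /= !ffunE conjgE !permM !permK.
  by [].
move=> _; rewrite raddfMz /= /permmod_actr permmod_act_basis odd_permJ.
by rewrite tabloid_of_act -!tabloid_actM conjgE !mulgA mulgV mul1g.
Qed.

Lemma in_specht_act x s : x \in in_specht -> permmod_act x s \in in_specht.
Proof.
move=> /in_spechtP[c ->]; rewrite -[permmod_act _ s]/(permmod_actr s _) raddf_sum.
apply: rpred_sum => t _; rewrite raddfMz /= /permmod_actr polytabloid_act.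
apply: rpredMz; apply/in_spechtP.
exists (fun t' => (t' == tableau_act t s)%:Z).
rewrite (bigD1 (tableau_act t s)) //= eqxx big1 ?addr0 //.
by move=> t' /negPf->; rewrite mulr0z.
Qed.

Definition specht_act (x : specht_type) (s : 'S_n) : specht_type :=
  Sub (permmod_act (val x) s) (in_specht_act s (valP x)).

Lemma specht_act1 : specht_act^~ 1%g =1 id.
Proof. by move=> x; apply: val_inj; rewrite /= permmod_act1. Qed.

Lemma specht_actM x : act_morph specht_act x.
Proof. by move=> s u; apply: val_inj; rewrite /= permmod_actM. Qed.

Lemma specht_actD (s : 'S_n) : {morph specht_act^~ s : x y / x + y}.
Proof.
by move=> x y; apply: val_inj; apply/ffunP => T; rewrite /= !ffunE.
Qed.

Definition specht : gmodule 'S_n :=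
  @GModule _ specht_type (TotalAction specht_act1 specht_actM) specht_actD.

End Specht.

(* p divides |A|, A being finite. *)
Definition dvd_card (p : nat) (A : Type) : Prop :=
  exists2 N : nat, ([set: A] #= `I_N)%card & (p %| N)%N.

Definition C1 (p : nat) : set (seq nat) :=
  (\bigcup_n [set la | is_partition n la /\ dvd_card p (H1 (specht n la))])%classic.

Lemma expn_unbounded (p m : nat) (p_prime : prime p) :
  exists r, (m < p ^ r)%N.
Proof. by exists m; rewrite ltn_expl // prime_gt1. Qed.

(* min { r | p ^ r > m } *)
Definition minexp (p m : nat) (p_prime : prime p) : nat :=
  ex_minn (expn_unbounded m p_prime).

(* Main.v *)
From Pilot Require Import Defs.
From HB Require Import structures.
From mathcomp Require Import all_boot all_order all_algebra all_fingroup.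
From mathcomp Require Import all_solvable ring_quotient zify.
From mathcomp Require Import boolp classical_sets functions cardinality.
From mathcomp Require Import fintype finset.
Import Pilot.Defs.

Set Implicit Arguments.
Unset Strict Implicit.
Unset Printing Implicit Defensive.

Import GRing.Theory.

(** Write S for the integral Specht module inside the module M of tabloids, G for
    the symmetric group and f for the sum of all tabloids.

    For la different from (n) no nonzero element of S is G-invariant, so the
    sequence 0 -> S -> S -> S/pS -> 0, whose first map is multiplication by p,
    identifies the p-torsion of H^1(G, S) with (S/pS)^G ([H1_torsionP]). The group
    H^1(G, S) is finite ([H1_finite]), hence by the theorem of Cauchy p divides its
    order if and only if S/pS has a nonzero invariant. Since S is a pure subgroup
    of M ([specht_pure]) and G permutes the tabloids transitively, such an
    invariant is represented by an element of S congruent to a nonzero multiple of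
    f modulo pM. For la = (n) the action is trivial and H^1(G, S) = Hom(G, Z) has
    no torsion.

    It remains to decide whether S contains an element congruent to f modulo p.
    The tool is a description of S by linear equations. Given a tabloid T and a set
    Z of la_i + 1 entries from its rows i and i+1, the Garnir sum of x is the sum of
    the coefficients in x of the tabloids obtained from T by redistributing Z over
    these two rows. Garnir sums vanish on polytabloids, by the pigeonhole principle
    ([garnir_sum_polytabloid]). Conversely, if all Garnir sums of x vanish modulo
    N, then x is congruent modulo N to an element of S ([straightening]): the
    heaviest tabloid of x modulo N has to be standard, because otherwise it is the
    lightest term of some Garnir sum ([nonstandard_shuffle]), and a standard one is
    removed by subtracting a multiple of a polytabloid ([polytabloid_leading]). The
    case N = 0 gives the purity of S, and the case N = p the elements of S that are
    congruent to f.

    The Garnir sum of f for T and Z is the binomial coefficient (la_i + 1 choose y),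
    where y is the number of entries of Z in row i+1 of T ([card_shuffles]), and y
    takes all the values 1, ..., la_(i+1). These coefficients are all divisible by
    p exactly when la_i + 1 is divisible by the least power of p that exceeds
    la_(i+1) ([expn_dvd_binP]), which is the condition of the theorem. *)

(** * Finite sets and sorted sequences *)

Lemma exists_subset_card (I : finType) (A : {set I}) c :
  c <= #|A| -> exists2 B : {set I}, B \subset A & #|B| = c.
Proof.
move=> cA; have: 0 < #|[set B : {set I} | (B \subset A) && (#|B| == c)]|.
  by rewrite cards_draws bin_gt0.
by case/card_gt0P => B; rewrite inE => /andP[BA /eqP cB]; exists B.
Qed.

Lemma nth_sorted_geq la i : sorted geq la -> nth 0 la i.+1 <= nth 0 la i.
Proof.
move=> la_sorted; have [ilt|ige] := ltnP i.+1 (size la); last by rewrite nth_default.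
have geq_trans : transitive geq by move=> b a c ba cb; apply: leq_trans cb ba.
exact: (sorted_leq_nth geq_trans leqnn 0 la_sorted _ _ (ltnW ilt) ilt).
Qed.

(** * Binomial coefficients divisible by a prime *)

(** In y * 'C(N, y) = N * 'C(N.-1, y.-1) the factor y cannot absorb all of the
    p ^ z in N. *)
Lemma prime_dvd_bin_expn (p z N y : nat) :
  prime p -> p ^ z %| N -> 0 < y < p ^ z -> p %| 'C(N, y).
Proof.
move=> p_pr pN /andP[y0 ylt]; apply: contraLR ylt => npC; rewrite -leqNgt.
have : p ^ z %| y * 'C(N, y).
  case: y y0 {npC} => // y _; case: N pN => [_|N pN].
    by rewrite bin0n muln0 dvdn0.
  by rewrite -mul_bin_diag dvdn_mulr.
rewrite Gauss_dvdl; first exact: dvdn_leq.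
by rewrite coprimeXl // prime_coprime.
Qed.

(** For q the largest power of p dividing N, p does not divide 'C(N, q), so that q
    has to lie beyond m. *)
Lemma all_dvd_bin_expn (p N m : nat) :
    prime p -> 0 < N -> (forall y, 0 < y <= m -> p %| 'C(N, y)) ->
  m < p ^ logn p N.
Proof.
move=> p_pr N0 pC; rewrite ltnNge; apply/negP => mge.
set a := logn p N in mge; set q := p ^ a in mge.
have q0 : 0 < q by rewrite expn_gt0 prime_gt0.
have [u pu Nu] := pfactor_coprime p_pr N0.
rewrite -/a -/q in Nu.
(* modulo p, row N - 1 of Pascal's triangle alternates between 1 and -1 up to
   p ^ a - 1 *)
have npC k : k < q -> ~~ (p %| 'C(N.-1, k)).
  elim: k => [|k IHk] kq; first by rewrite bin0 dvdn1 neq_ltn prime_gt1 ?orbT.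
  have: p %| 'C(N, k.+1).
    apply: (@prime_dvd_bin_expn _ a) => //.
    by rewrite Nu dvdn_mull.
  rewrite -(prednK N0) binS => pS; apply/negP => pk.
  by move: pS; rewrite dvdn_addr //; apply/negP/IHk/ltnW.
have := pC q; rewrite q0 mge => /(_ isT); apply/negP.
have: q * 'C(N, q) = q * (u * 'C(N.-1, q.-1)).
  by rewrite -{1 2}(prednK q0) -{1}(prednK N0) -mul_bin_diag (prednK N0) {1}Nu; lia.
move/eqP; rewrite eqn_pmul2l // => /eqP ->.
by rewrite Euclid_dvdM // negb_or npC ?prednK // -prime_coprime ?pu.
Qed.

Lemma expn_dvd_binP (p N m z : nat) :
    prime p -> 0 < N -> m < p ^ z -> (forall r, m < p ^ r -> z <= r) ->
  p ^ z %| N <-> (forall y, 0 < y <= m -> p %| 'C(N, y)).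
Proof.
move=> p_pr N0 mz zmin; split=> [pN y /andP[y0 ym]|pC].
  by apply: prime_dvd_bin_expn pN _ => //; rewrite y0 (leq_ltn_trans ym).
by rewrite pfactor_dvdn // zmin // all_dvd_bin_expn.
Qed.

(** * Tabloids *)

Section Tabloids.
Variables (n : nat) (la : seq nat).

Definition trow (T : tabloid n la) (k : 'I_n) : nat := val T k.

Lemma trow_inj (T T' : tabloid n la) : trow T =1 trow T' -> T = T'.
Proof. by move=> eqT; apply/val_inj/ffunP => k; apply/val_inj/eqT. Qed.

Lemma trow_lt T k : trow T k < size la.
Proof. exact: ltn_ord. Qed.

Lemma card_trow T i : #|[set k | trow T k == i]| = nth 0 la i.
Proof.
have [ilt|ige] := ltnP i (size la).
  have /eqP <- := forallP (valP T) (Ordinal ilt).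
  by apply: eq_card => k; rewrite !inE.
rewrite nth_default //; apply: eq_card0 => k; rewrite !inE.
by apply/negbTE; rewrite neq_ltn (leq_trans (trow_lt T k)).
Qed.

Lemma trow_act T s k : trow (tabloid_act T s) k = trow T ((s^-1)%g k).
Proof. by rewrite /trow /= ffunE. Qed.

(** Two tabloids, read as words in the rows, are rearrangements of each other. *)
Lemma tabloid_act_trans (T T' : tabloid n la) : exists s, T' = tabloid_act T s.
Proof.
have: perm_eq [tuple trow T' k | k < n] [tuple trow T k | k < n].
  apply/allP => i _ /=; apply/eqP.
  have cnt (U : tabloid n la) :
      count_mem i [seq trow U k | k <- enum 'I_n] = nth 0 la i.
    by rewrite -(card_trow U i) -sum1_count big_map big_enum_cond sum1dep_card.
  by rewrite !cnt.
case/tuple_permP => s eqs; exists (s^-1)%g; apply: trow_inj => k.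
rewrite trow_act invgK.
have /(congr1 (fun u => tnth u k)) := val_inj eqs.
by rewrite !tnth_mktuple.
Qed.

(** Reading the rows of the entries as digits, with the largest entry as the
    leading digit, turns the usual total order on tabloids into an integer. *)
Definition weight (T : tabloid n la) := \sum_k trow T k * size la ^ k.

Lemma weight_lt (T T' : tabloid n la) (k0 : 'I_n) :
    (forall k : 'I_n, k0 < k -> trow T k = trow T' k) -> trow T k0 < trow T' k0 ->
  weight T < weight T'.
Proof.
move=> eqT ltT; rewrite /weight (bigID (fun k : 'I_n => k < k0)) /=.
rewrite [X in _ < X](bigID (fun k : 'I_n => k < k0)) /=.
rewrite !(bigD1 (P := fun k : 'I_n => ~~ (k < k0)) k0) ?ltnn //=.
have ->: \sum_(k < n | ~~ (k < k0) && (k != k0)) trow T k * size la ^ k =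
          \sum_(k < n | ~~ (k < k0) && (k != k0)) trow T' k * size la ^ k.
  apply: eq_bigr => k /andP[kk0 nkk0].
  by rewrite eqT // ltn_neqAle leqNgt kk0 andbT eq_sym.
have lt_low: \sum_(k < n | k < k0) trow T k * size la ^ k < size la ^ k0.
  have b0: 0 < size la by apply: leq_ltn_trans (trow_lt T k0).
  apply: (@leq_ltn_trans (\sum_(k < n | k < k0) (size la).-1 * size la ^ k)).
    by apply: leq_sum => k _; rewrite leq_mul // -ltnS prednK // trow_lt.
  rewrite (big_ord_narrow (ltnW (ltn_ord k0))) -big_distrr /= -predn_exp.
  by rewrite ltn_predL expn_gt0 b0.
rewrite !addnA ltn_add2r; apply: leq_trans (_ : trow T' k0 * size la ^ k0 <= _).
  apply: leq_trans (_ : (trow T k0).+1 * size la ^ k0 <= _).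
    by rewrite mulSn ltn_add2r.
  by rewrite leq_mul2r ltT orbT.
exact: leq_addl.
Qed.

(** * Garnir sums *)

(** When the entries of Z lie in rows i and i.+1 of T, these are the tabloids
    that are obtained from T by redistributing Z over the two rows. *)
Definition shuffles (T : tabloid n la) (i : nat) (Z : {set 'I_n})
    (T' : tabloid n la) : bool :=
  [forall k, if k \in Z then (trow T' k == i) || (trow T' k == i.+1)
             else trow T' k == trow T k].

Lemma shufflesP T i (Z : {set 'I_n}) T' :
  reflect ((forall k, k \in Z -> trow T' k = i \/ trow T' k = i.+1) /\
           (forall k, k \notin Z -> trow T' k = trow T k))
          (shuffles T i Z T').
Proof.
apply: (iffP forallP) => [H|[H1 H2] k].
  split=> k kZ; have := H k; first by rewrite kZ => /orP[]/eqP; [left|right].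
  by rewrite (negbTE kZ) => /eqP.
by case: ifP => [/H1[]->|/negbT/H2->]; rewrite ?eqxx ?orbT.
Qed.

Definition garnir_sum (x : permmod n la) T i Z : int :=
  (\sum_(T' | shuffles T i Z T') x T')%R.

Lemma polytabloidE (t : tableau n la) T : (polytabloid t T =
  \sum_(s in colstab t | tabloid_act (tabloid_of t) s == T) (-1) ^+ s :> int)%R.
Proof.
rewrite /polytabloid sum_ffunE [RHS]big_mkcondr; apply: eq_bigr => s _.
rewrite ffunMzE ffunE eq_sym; case: eqP => _ /=; last by rewrite mul0rz.
by rewrite intz.
Qed.

Lemma col_lt (t : tableau n la) k : col t k < nth 0 la (row t k).
Proof. exact: ltn_ord. Qed.

(** As Z has more entries than row i has boxes, two of its entries lie in the
    same column of t, and swapping them reverses all signs. *)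
Lemma garnir_sum_polytabloid t T i (Z : {set 'I_n}) :
    sorted geq la -> #|Z| = (nth 0 la i).+1 ->
  garnir_sum (polytabloid t) T i Z = 0%R.
Proof.
move=> la_sorted cardZ.
pose good s := shuffles T i Z (tabloid_act (tabloid_of t) s).
have ->: (garnir_sum (polytabloid t) T i Z =
          \sum_(s in colstab t | good s) (-1) ^+ s)%R.
  rewrite /garnir_sum.
  under eq_bigr do rewrite polytabloidE.
  rewrite (exchange_big_dep (fun s => (s \in colstab t) && good s)) /=.
    apply: eq_bigr => s /andP[sC gs].
    rewrite (big_pred1 (tabloid_act (tabloid_of t) s)) // => T' /=.
    by rewrite sC eq_sym; case: eqP => [->|]; rewrite ?andbF ?andbT.
  by move=> T' s shT' /andP[-> /eqP sT']; rewrite /good sT'.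
have [s0 /andP[s0C gs0]|none] :=
    pickP (fun s => (s \in colstab t) && good s); last first.
  by rewrite big_pred0.
have colZ k : k \in Z -> col t k < nth 0 la i.
  move=> kZ; move: s0C; rewrite inE => /forallP/(_ ((s0^-1)%g k)).
  rewrite permKV => /eqP->; apply: leq_trans (col_lt t _) _.
  have /shufflesP[/(_ k kZ) + _] := gs0.
  rewrite trow_act /trow /= ffunE => -[->//|->].
  exact: nth_sorted_geq.
have [a aZ [b bZ [ab cab]]] : exists2 a, a \in Z & exists2 b, b \in Z &
    a != b /\ col t a = col t b.
  pose c k : 'I_(nth 0 la i).-1.+1 := inord (col t k).
  have cE k : k \in Z -> c k = col t k :> nat.
    by move=> /colZ kc; rewrite inordK // (ltn_predK kc).
  have [inj|] := boolP (dinjectiveb c (mem Z)).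
    have /card_gt0P[k /colZ kc] : 0 < #|Z| by rewrite cardZ.
    have /dinjectiveP/leq_card_in := inj.
    by rewrite card_ord (ltn_predK kc) [#|_|]cardZ ltnn.
  case/dinjectivePn => a aZ [b bZ eqc]; exists a => //; exists b.
    by case/andP: bZ.
  by move: bZ; rewrite inE /= => /andP[ba bZ]; rewrite eq_sym -!cE ?eqc.
have abC : tperm a b \in colstab t.
  by rewrite inE; apply/forallP => k; case: tpermP => // ->; rewrite cab.
have colM s : ((s * tperm a b)%g \in colstab t) = (s \in colstab t).
  rewrite !inE; apply: eq_forallb => k; rewrite permM; congr (_ == _).
  by case: tpermP => // ->; rewrite cab.
have goodM s : good (s * tperm a b)%g = good s.
  suff imp u : good u -> good (u * tperm a b)%g.
    by apply/idP/idP => /imp //; rewrite -mulgA tperm2 mulg1.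
  move=> /shufflesP[gZ gNZ]; apply/shufflesP.
  split=> k kZ; rewrite tabloid_actM trow_act tpermV.
    by apply: gZ; case: tpermP.
  by rewrite tpermD ?gNZ //; apply: contraNneq kZ => <-.
have sumN : (\sum_(s in colstab t | good s) (-1) ^+ s =
             - \sum_(s in colstab t | good s) (-1) ^+ s :> int)%R.
  rewrite {1}(reindex_inj (mulIg (tperm a b))) /= -sumrN.
  apply: eq_big => s; first by rewrite colM goodM.
  by move=> _; rewrite odd_permM odd_tperm ab addbT signrN.
by lia.
Qed.

End Tabloids.

Section Straightening.
Variables (n : nat) (la : seq nat).
Hypothesis la_n : is_partition n la.

Let la_sorted : sorted geq la. Proof. by case/and3P: la_n. Qed.

(** * Standard tabloids *)

(** For k in row i, this is the column of k when the rows are increasing. *)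
Definition below (T : tabloid n la) (i : nat) (k : 'I_n) : nat :=
  #|[set k' : 'I_n | (k' < k) && (trow T k' == i)]|.

Lemma below_le T i (k k' : 'I_n) : k <= k' -> below T i k <= below T i k'.
Proof.
move=> kk'; apply/subset_leq_card/subsetP => j; rewrite !inE.
by case/andP=> jk ->; rewrite (leq_trans jk).
Qed.

Lemma below_lt T (k k' : 'I_n) :
  k < k' -> below T (trow T k) k < below T (trow T k) k'.
Proof.
move=> kk'; apply/proper_card/properP; split; last first.
  by exists k; rewrite !inE ?kk' ?eqxx ?ltnn.
apply/subsetP => j; rewrite !inE.
by case/andP=> jk ->; rewrite (ltn_trans jk).
Qed.

Lemma below_leq_row T i k : below T i k <= nth 0 la i.
Proof.
rewrite -(card_trow T); apply/subset_leq_card/subsetP => j; rewrite !inE.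
by case/andP.
Qed.

Lemma below_lt_row T k : below T (trow T k) k < nth 0 la (trow T k).
Proof.
rewrite -(card_trow T); apply/proper_card/properP; split; last first.
  by exists k; rewrite !inE ?eqxx ?ltnn.
by apply/subsetP => j; rewrite !inE => /andP[].
Qed.

Lemma below_inj T (k k' : 'I_n) : trow T k = trow T k' ->
  below T (trow T k) k = below T (trow T k') k' -> k = k'.
Proof.
move=> eqr eqb; have [kk'|k'k|/val_inj//] := ltngtP (val k) (val k').
  by have := below_lt T kk'; rewrite eqb eqr ltnn.
by have := below_lt T k'k; rewrite -eqb eqr ltnn.
Qed.

Definition box_of (T : tabloid n la) (k : 'I_n) : box la :=
  Tagged (fun i : 'I_(size la) => 'I_(nth 0 la i)) (Ordinal (below_lt_row T k)).

Lemma box_of_inj T : injective (box_of T).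
Proof.
move=> k k' eqb.
have eqr : trow T k = trow T k'
    := congr1 (fun b : box la => nat_of_ord (tag b)) eqb.
apply: (below_inj eqr).
by have /= := congr1 (fun b : box la => nat_of_ord (tagged b)) eqb.
Qed.

Lemma card_box : #|{: box la}| = n.
Proof.
rewrite /box card_tagged; have /and3P[_ _ /eqP <-] := la_n; congr sumn.
under eq_map do rewrite card_ord.
by rewrite (map_comp (nth 0 la) val) val_enum_ord map_nth_iota0 // take_size.
Qed.

Lemma box_of_surj T b : exists k, box_of T k = b.
Proof.
have [|g _ gK] := inj_card_bij (@box_of_inj T); first by rewrite card_box card_ord.
by exists (g b).
Qed.

Lemma exists_below T i c : c < nth 0 la i ->
  exists2 k, trow T k = i & below T i k = c.
Proof.
move=> ci; have [ilt|ige] := ltnP i (size la); last first.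
  by rewrite nth_default in ci.
have [k kb] := box_of_surj T (Tagged (fun i : 'I_(size la) => 'I_(nth 0 la i))
                                 (Ordinal (ci : c < nth 0 la (Ordinal ilt)))).
have kr : trow T k = i := congr1 (fun b : box la => nat_of_ord (tag b)) kb.
exists k => //; rewrite -{1}kr.
by have /= := congr1 (fun b : box la => nat_of_ord (tagged b)) kb.
Qed.

Lemma tableau_of_subproof T :
  [forall b, #|[set k | [ffun k => box_of T k] k == b]| == 1%N].
Proof.
apply/forallP => b; have [k <-] := box_of_surj T b.
rewrite (_ : [set _ | _] = [set k]) ?cards1 //; apply/setP => j.
by rewrite !inE ffunE (inj_eq (@box_of_inj T)).
Qed.

(** The rows of this tableau are increasing, because the column of an entry counts
    the smaller entries of its row. *)
Definition tableau_of T : tableau n la :=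
  Sub [ffun k => box_of T k] (tableau_of_subproof T).

Lemma tableau_ofK T : tabloid_of (tableau_of T) = T.
Proof. by apply: trow_inj => k; rewrite /trow /= ffunE /Defs.row /= ffunE. Qed.

Lemma col_tableau_of T k : Defs.col (tableau_of T) k = below T (trow T k) k.
Proof. by rewrite /Defs.col /= ffunE. Qed.

(** Comparing, for each entry k outside row 0, the column of k with the number
    of entries smaller than k in the row above expresses that the columns of the
    tableau with increasing rows increase too. *)
Definition standard T :=
  [forall k, (trow T k > 0) ==>
     (below T (trow T k) k < below T (trow T k).-1 k)].

(** Climb one row at a time within the column of k', starting from k'. *)
Lemma standard_col T (k k' : 'I_n) : standard T ->
    below T (trow T k) k = below T (trow T k') k' -> trow T k < trow T k' ->
  k < k'.
Proof.
move=> /forallP stT + /subnKC; move: (_ - _) => d; rewrite addSnnS.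
have chain e j : e = trow T j -> 0 < e -> exists2 j', trow T j' = e.-1 &
    below T e.-1 j' = below T e j /\ j' < j.
  move=> -> /(implyP (stT j)) ltb.
  have [j' j'r j'b] := exists_below T (leq_trans ltb (below_leq_row T _ _)).
  exists j' => //; split=> //; rewrite ltnNge; apply/negP.
  move/(below_le T (trow T j).-1).
  by rewrite j'b leqNgt ltb.
elim: d k' => [|d IHd] k' eqb eqr.
  have [j jr [jb jk']] := chain _ k' eqr (ltn_addl _ (ltn0Sn _)).
  rewrite addn1 /= in jr jb.
  by rewrite (below_inj (esym jr)) // eqb jr jb -eqr addn1.
have [j jr [jb jk']] := chain _ k' eqr (ltn_addl _ (ltn0Sn _)).
rewrite addnS /= in jr jb; apply: ltn_trans jk'; apply: IHd => //.
by rewrite eqb jr jb -eqr addnS.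
Qed.

(** The largest entry moved by a column permutation of a column-increasing
    tableau moves up. *)
Lemma weight_colstab T s : standard T -> s \in colstab (tableau_of T) -> s != 1%g ->
  weight (tabloid_act T s) < weight T.
Proof.
move=> stT sC s1.
have [k1 sk1] : exists k, s k != k.
  apply/existsP; apply: contraR s1 => /existsPn fix_s; apply/eqP/permP => k.
  by rewrite perm1; apply/eqP/negPn/fix_s.
case: (arg_maxnP (P := fun k => s k != k) val sk1) => k0 sk0 k0max {k1 sk1}.
set k1 := (s^-1)%g k0.
have k1k0 : k1 < k0.
  have k1N : k1 != k0 by apply: contraNneq sk0 => k10; rewrite -{1}k10 permKV.
  by rewrite ltn_neqAle k1N; apply: k0max; rewrite permKV eq_sym.
apply: (weight_lt (k0 := k0)) => [k k0k|]; rewrite trow_act.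
  suff -> : (s^-1)%g k = k by [].
  apply/(@perm_inj _ s); rewrite permKV; apply/esym/eqP.
  by apply: contraTT k0k => /k0max; rewrite -leqNgt.
have col10 : below T (trow T k1) k1 = below T (trow T k0) k0.
  move: sC; rewrite inE => /forallP/(_ k1)/eqP.
  by rewrite permKV !col_tableau_of.
rewrite -/k1; have [//|gt|eqr] := ltngtP (trow T k1) (trow T k0).
  by have := standard_col stT (esym col10) gt; rewrite ltnNge ltnW.
by have := below_inj eqr col10 => k10; rewrite k10 ltnn in k1k0.
Qed.

Lemma polytabloid_leading T T' : standard T -> weight T <= weight T' ->
  polytabloid (tableau_of T) T' = (T' == T)%:Z%R.
Proof.
move=> stT TT'; rewrite polytabloidE tableau_ofK.
have C1 : 1%g \in colstab (tableau_of T).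
  by rewrite inE; apply/forallP => k; rewrite perm1.
have only1 s : s \in colstab (tableau_of T) -> tabloid_act T s = T' -> s = 1%g.
  move=> sC eqT'; apply/eqP/negPn/negP => /(weight_colstab stT sC).
  by rewrite eqT' ltnNge TT'.
case: eqP => [eqT|neqT].
  rewrite (big_pred1 1%g) ?odd_perm1 // => s /=.
  apply/andP/eqP => [[sC /eqP sT]|->]; first exact: only1.
  by rewrite C1 tabloid_act1 eqT.
rewrite big_pred0 // => s; apply/negP => /andP[sC /eqP sT].
by apply: neqT; rewrite -sT (only1 s) // tabloid_act1.
Qed.

(** If an entry k of row i.+1 has a larger entry above it, the entries of row
    i.+1 up to k and enough of the entries of row i beyond k are more than row i
    can hold, and every other way of shuffling them is heavier, because it moves
    a larger entry down. *)
Lemma nonstandard_shuffle T : ~~ standard T -> exists i (Z : {set 'I_n}),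
  [/\ #|Z| = (nth 0 la i).+1, shuffles T i Z T &
      forall T', shuffles T i Z T' -> T' != T -> weight T < weight T'].
Proof.
rewrite negb_forall => /existsP[k]; rewrite negb_imply -leqNgt.
case kr: (trow T k) => [//|i] /andP[_ /= leb]; exists i.
pose Y := [set k' : 'I_n | (k' <= k) && (trow T k' == i.+1)].
pose X0 := [set k' : 'I_n | (k < k') && (trow T k' == i)].
have cardY : #|Y| = (below T i.+1 k).+1.
  rewrite -[RHS]add1n -(cards1 k) /below -cardsUI.
  rewrite [X in _ = (_ + #|pred_of_set X|)%N](_ : _ = set0) ?cards0 ?addn0; last first.
    apply/setP => k'; rewrite !inE; case: eqP => // ->.
    by rewrite ltnn.
  apply: eq_card => k'; rewrite !inE leq_eqVlt andb_orl; congr orb.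
  by rewrite (inj_eq val_inj); case: eqP => // ->; rewrite kr eqxx.
have cardX0 : nth 0 la i = below T i k + #|X0|.
  rewrite -(card_trow T i) /below -cardsUI.
  rewrite [X in _ = (_ + #|pred_of_set X|)%N](_ : _ = set0) ?cards0 ?addn0; last first.
    apply/setP => k'; by rewrite !inE; case: ltngtP; rewrite /= ?andbF.
  apply: eq_card => k'; rewrite !inE -andb_orl -neq_ltn.
  by case: (trow T k' =P i) => [k'i|]; rewrite ?andbF // andbT; apply/esym/eqP => kk';
    move: kr; rewrite -(val_inj kk') k'i => /eqP; rewrite ltn_eqF.
have ltb : below T i.+1 k < nth 0 la i.
  have := below_lt_row T k; rewrite kr => /leq_trans; apply.
  exact: nth_sorted_geq.
have [|X XX0 cardX] := @exists_subset_card _ X0 (nth 0 la i - below T i.+1 k).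
  by rewrite cardX0 leq_subLR leq_add2r.
have inX k' : k' \in X -> k < k' /\ trow T k' = i.
  by move/(subsetP XX0); rewrite inE => /andP[? /eqP].
exists (X :|: Y); split.
- rewrite cardsU (_ : X :&: Y = set0) ?cards0 ?subn0; last first.
    apply/setP => k'; rewrite !inE; apply/negP => /and3P[/inX[kk' _]].
    by rewrite leqNgt kk'.
  by rewrite cardX cardY addnS subnK // ltnW.
- apply/shufflesP; split=> // k'; rewrite !inE.
  by case/orP => [/inX[_ ->]|/andP[_ /eqP->]]; [left|right].
move=> T' /shufflesP[shZ shNZ] neqT.
have [k1 Tk1] : exists k1, trow T' k1 != trow T k1.
  apply/existsP; apply: contraR neqT => /existsPn eqT; apply/eqP/trow_inj => j.
  by apply/eqP/negPn/eqT.
case: (arg_maxnP (P := fun j => trow T' j != trow T j) val Tk1).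
move=> k0 Tk0 k0max {k1 Tk1}.
have k0Z : k0 \in X :|: Y by apply: contraR Tk0 => /shNZ ->.
have eqT (j : 'I_n) : k0 < j -> trow T j = trow T' j.
  by move=> k0j; apply/esym/eqP; apply: contraTT k0j => /k0max; rewrite -leqNgt.
have [T'k0|T'k0] := shZ _ k0Z; last first.
  apply: (weight_lt (k0 := k0) eqT); rewrite T'k0.
  move: k0Z Tk0; rewrite T'k0 !inE => /orP[/inX[_ ->] //|/andP[_ /eqP->]].
  by rewrite eqxx.
(* otherwise row i.+1 of T' would be a proper part of row i.+1 of T *)
have [k0k Tk0E] : k0 <= k /\ trow T k0 = i.+1.
  move: k0Z Tk0; rewrite T'k0 !inE => /orP[/inX[_ ->]|/andP[? /eqP->]] //.
  by rewrite eqxx.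
suff: #|[set j | trow T' j == i.+1]| < #|[set j | trow T j == i.+1]|.
  by rewrite !card_trow ltnn.
apply/proper_card/properP; split; last first.
  by exists k0; rewrite !inE ?Tk0E ?T'k0 ?eqxx // ltn_eqF.
apply/subsetP => j; rewrite !inE => /eqP T'j.
have [<-|Tj] := eqVneq (trow T' j) (trow T j); first by rewrite T'j.
have jk0 := k0max j Tj.
have : j \in X :|: Y by apply: contraR Tj => /shNZ ->.
rewrite !inE => /orP[/inX[kj _]|/andP[_ //]].
by move: kj; rewrite ltnNge (leq_trans jk0 k0k).
Qed.

Lemma garnir_sumB (x y : permmod n la) T i Z :
  garnir_sum (x - y)%R T i Z = (garnir_sum x T i Z - garnir_sum y T i Z)%R.
Proof.
by rewrite /garnir_sum -sumrB; apply: eq_bigr => T' _; rewrite !ffunE.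
Qed.

Lemma garnir_sum_specht x T i (Z : {set 'I_n}) :
    x \in @in_specht n la -> #|Z| = (nth 0 la i).+1 ->
  garnir_sum x T i Z = 0%R.
Proof.
case/in_spechtP => c -> cardZ; rewrite /garnir_sum.
under eq_bigr do rewrite sum_ffunE.
rewrite exchange_big big1 //= => t _.
under eq_bigr do rewrite ffunMzE.
by rewrite -mulrz_suml [X in (X *~ _)%R]garnir_sum_polytabloid // mul0rz.
Qed.

(** The leading tabloids of x modulo N are removed by subtracting
    polytabloids when they are standard, and their coefficients vanish modulo N
    because of a Garnir sum when they are not. For N = 0 this identifies the
    Specht module with the common kernel of the Garnir sums. *)
Lemma straightening (N : int) (x : permmod n la) :
    (forall T i (Z : {set 'I_n}), #|Z| = (nth 0 la i).+1 -> shuffles T i Z T ->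
       (N %| garnir_sum x T i Z)%Z) ->
  exists2 y, y \in @in_specht n la & forall T, (N %| (x T - y T)%R)%Z.
Proof.
have: exists W, forall T, W <= weight T -> (N %| x T)%Z.
  exists (\sum_(T : tabloid n la) weight T).+1 => T; rewrite ltnNge => /negP[].
  by rewrite (bigD1 T) //= leq_addr.
(* the coefficients of x in weight W and above vanish modulo N *)
case=> W; elim: W x => [|W IHW] x xW xG.
  by exists 0%R => [|T]; rewrite ?rpred0 // !ffunE subr0 xW.
pose lead T := standard T && (weight T == W).
pose y : permmod n la :=
  (\sum_(T | lead T) polytabloid (tableau_of T) *~ x T)%R.
have yS : y \in @in_specht n la.
  rewrite rpred_sum // => T _; rewrite rpredMz //; apply/in_spechtP.
  exists (fun t => (t == tableau_of T)%:Z%R); rewrite (bigD1 (tableau_of T)) //=.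
  by rewrite eqxx big1 ?addr0 // => t /negPf->; rewrite mulr0z.
have yW T : W <= weight T -> y T = (if lead T then x T else 0)%R.
  move=> WT; rewrite sum_ffunE.
  rewrite (eq_bigr (fun T' => if T' == T then x T else 0%R)) => [|T'];
    last case/andP=> stT' /eqP wT'.
    rewrite -big_mkcondr /=; case: ifP => lT.
      rewrite (big_pred1 T) // => T' /=.
      by case: (T' =P T) => [->|]; rewrite ?andbF // lT.
    rewrite big_pred0 // => T'.
    by case: (T' =P T) => [->|]; rewrite ?andbF // lT.
  rewrite ffunMzE polytabloid_leading ?wT' // eq_sym.
  by case: eqP => [->|]; rewrite ?mul0rz // intz.
have [T WT|T i Z cZ shZ|z zS xyz] := IHW (x - y)%R.
- rewrite !ffunE yW //; case: ifPn => [_|]; first by rewrite subrr dvdz0.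
  rewrite subr0 negb_and => nlT.
  have [ltW|] := ltnP W (weight T); first exact: xW.
  move=> leW; have wT : weight T = W by apply/eqP; rewrite eqn_leq leW WT.
  move: nlT; rewrite wT eqxx orbF => /nonstandard_shuffle[i [Z [cZ shT wZ]]].
  have := xG T i Z cZ shT; rewrite /garnir_sum (bigD1 T) //= rpredDr //.
  by apply: rpred_sum => T' /andP[shT' neqT]; rewrite xW // -wT wZ.
- by rewrite garnir_sumB (garnir_sum_specht _ yS) // subr0 xG.
exists (y + z)%R => [|T]; first by rewrite rpredD.
by rewrite !ffunE opprD addrA; have := xyz T; rewrite !ffunE.
Qed.

End Straightening.

(** * Garnir sums of constants *)

Section Constants.
Variables (n : nat) (la : seq nat).
Hypothesis la_n : is_partition n la.

Let la_sorted : sorted geq la. Proof. by case/and3P: la_n. Qed.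

Definition lowered (T : tabloid n la) (i : nat) (Z : {set 'I_n}) : {set 'I_n} :=
  [set k in Z | trow T k == i.+1].

Lemma card_row_on (u : 'I_n -> nat) i j (Z : {set 'I_n}) :
    (forall k, k \in Z -> u k = i \/ u k = i.+1) ->
  let y := #|[set k in Z | u k == i.+1]| in
  #|[set k in Z | u k == j]| =
    if j == i.+1 then y else if j == i then #|Z| - y else 0.
Proof.
move=> uZ y; case: eqP => [->//|ji1]; case: eqP => [->|ji].
  rewrite -(cardsID [set k | u k == i.+1] Z).
  rewrite (_ : _ :&: _ = [set k in Z | u k == i.+1]); last first.
    by apply/setP => k; rewrite !inE.
  rewrite addKn; apply: eq_card => k; rewrite !inE andbC.
  have [kZ|] := boolP (k \in Z); rewrite ?andbF //= !andbT.
  by have [->|->] := uZ k kZ; lia.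
apply: eq_card0 => k; rewrite !inE; apply/negP => /andP[kZ /eqP uk].
by have [] := uZ k kZ; rewrite uk.
Qed.

Lemma shuffles_lowered_inj T i (Z : {set 'I_n}) T1 T2 :
    shuffles T i Z T1 -> shuffles T i Z T2 -> lowered T1 i Z = lowered T2 i Z ->
  T1 = T2.
Proof.
move=> /shufflesP[Z1 NZ1] /shufflesP[Z2 NZ2] eqD; apply: trow_inj => k.
have [kZ|kNZ] := boolP (k \in Z); last by rewrite NZ1 ?NZ2.
move/setP/(_ k): eqD; rewrite !inE kZ /=.
by have [->|->] := Z1 k kZ; have [->|->] := Z2 k kZ; lia.
Qed.

Lemma card_trow_split (T : tabloid n la) (Z : {set 'I_n}) j : nth 0 la j =
  #|[set k in Z | trow T k == j]| + #|[set k in ~: Z | trow T k == j]|.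
Proof.
rewrite -(card_trow T j) -(cardsID Z [set k | trow T k == j]).
congr (_ + _); apply: eq_card => k.
  by rewrite !inE andbC.
by rewrite !inE andbC.
Qed.

Lemma shuffles_card_lowered (T : tabloid n la) i (Z : {set 'I_n}) T' :
  shuffles T i Z T' -> #|lowered T' i Z| = #|lowered T i Z|.
Proof.
move=> /shufflesP[_ NZ']; apply/eqP.
rewrite -(eqn_add2r #|[set k in ~: Z | trow T k == i.+1]|) -card_trow_split.
rewrite (card_trow_split T' Z); apply/eqP; congr (_ + _); apply: eq_card => k.
by rewrite !inE; case: (boolP (k \in Z)) => //= /NZ'->.
Qed.

Lemma shuffles_lowered_surj (T : tabloid n la) i (Z B : {set 'I_n}) :
    shuffles T i Z T -> B \subset Z -> #|B| = #|lowered T i Z| ->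
  exists2 T', shuffles T i Z T' & lowered T' i Z = B.
Proof.
move=> /shufflesP[ZT _] BZ cardB.
have lt1 k : k \in B -> i.+1 < size la.
  move=> kB; have : 0 < #|lowered T i Z| by rewrite -cardB; apply/card_gt0P; exists k.
  by case/card_gt0P => k'; rewrite inE => /andP[_ /eqP <-]; apply: trow_lt.
have lt0 k : k \in Z -> i < size la.
  by have := trow_lt T k; move=> Tk /ZT[] kZ; lia.
(* the default value of insubd never occurs: if B or Z is not empty, then the rows
   that its entries are sent to are rows of T *)
pose f := [ffun k => insubd (val T k) (if k \in B then i.+1 else if k \in Z then i
                                       else trow T k)].
have fE k : f k = (if k \in B then i.+1 else if k \in Z then i else trow T k) :> nat.
  rewrite ffunE val_insubd; have [/lt1 -> //|_] := boolP (k \in B).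
  by have [/lt0 -> //|_] := boolP (k \in Z); rewrite trow_lt.
have fT : [forall j, #|[set k | f k == j]| == nth 0 la j].
  apply/forallP => j; rewrite (card_trow_split T Z); apply/eqP.
  rewrite -(cardsID Z [set k | f k == j]); congr (_ + _); last first.
    apply: eq_card => k; rewrite !inE andbC.
    rewrite -(inj_eq val_inj) /= fE.
    have [kB|_] := boolP (k \in B); first by rewrite (subsetP BZ _ kB) andbF.
    by case: ifP; rewrite ?andbF ?andbT.
  rewrite (card_row_on j ZT) -cardB.
  rewrite -(_ : #|[set k in Z | (f k : nat) == i.+1]| = #|B|); last first.
    apply: eq_card => k; rewrite !inE fE.
    have [kB|_] := boolP (k \in B); first by rewrite (subsetP BZ _ kB) ?eqxx.
    by case: ifP; rewrite ?andbF // ltn_eqF.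
  rewrite -card_row_on; first by apply: eq_card => k; rewrite !inE andbC.
  by move=> k kZ; rewrite fE kZ; case: ifP; [right|left].
exists (Sub f fT : tabloid n la).
  apply/shufflesP; split=> k kZ; rewrite /trow /= fE.
    by rewrite kZ; case: ifP; [right|left].
  by rewrite ifN ?(negbTE kZ) //; apply: contra kZ => /(subsetP BZ).
apply/setP => k; rewrite !inE /trow /= fE.
have [kB|_] := boolP (k \in B); first by rewrite (subsetP BZ _ kB) ?eqxx.
by case: ifP; rewrite ?andbF // ltn_eqF.
Qed.

(** A shuffle is determined by the entries of Z that it puts in row i.+1, which
    can be any subset of Z of the right size. *)
Lemma card_shuffles (T : tabloid n la) i (Z : {set 'I_n}) : shuffles T i Z T ->
  #|[set T' | shuffles T i Z T']| = 'C(#|Z|, #|lowered T i Z|).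
Proof.
move=> shT; rewrite -cards_draws -(card_in_imset (f := fun T' => lowered T' i Z)).
  apply: eq_card => B; rewrite inE; apply/imsetP/andP => [[T']|[BZ /eqP cardB]].
    rewrite inE => shT' ->; split; last by rewrite (shuffles_card_lowered shT').
    by apply/subsetP => k; rewrite inE => /andP[].
  have [T' shT' <-] := shuffles_lowered_surj shT BZ cardB.
  by exists T'; rewrite ?inE.
by move=> T1 T2; rewrite !inE; apply: shuffles_lowered_inj.
Qed.

Lemma garnir_sum_const_mod (N : int) (x : permmod n la) T i (Z : {set 'I_n}) :
    shuffles T i Z T -> (forall T', (N %| (x T' - x T)%R)%Z) ->
  (N %| garnir_sum x T i Z)%Z = (N %| (x T *+ 'C(#|Z|, #|lowered T i Z|))%R)%Z.
Proof.
move=> shT xN; rewrite -card_shuffles // -sumr_const /garnir_sum.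
rewrite [X in _ = (_ %| X)%Z](eq_bigl (shuffles T i Z)) => [|T']; last by rewrite inE.
rewrite -[RHS](rpredDl _ (x := (\sum_(T' | shuffles T i Z T') (x T' - x T))%R)).
  by rewrite sumrB subrK.
by apply: rpred_sum => T' _; apply: xN.
Qed.

(** These binomial coefficients are the Garnir sums of the sum of all tabloids. *)
Definition garnir_bin (p : nat) :=
  forall i y, 0 < y <= nth 0 la i.+1 -> p %| 'C((nth 0 la i).+1, y).

Lemma exists_shuffle (T : tabloid n la) i y : 0 < y <= nth 0 la i.+1 ->
  exists Z : {set 'I_n},
    [/\ #|Z| = (nth 0 la i).+1, shuffles T i Z T & #|lowered T i Z| = y].
Proof.
move=> /andP[y0 yle].
have [|Y Yrow cardY] := @exists_subset_card _ [set k | trow T k == i.+1] y.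
  by rewrite card_trow.
have [|X Xrow cardX] :=
    @exists_subset_card _ [set k | trow T k == i] ((nth 0 la i).+1 - y).
  by rewrite card_trow leq_subLR -add1n leq_add2r.
have inX k : k \in X -> trow T k = i by move/(subsetP Xrow); rewrite inE => /eqP.
have inY k : k \in Y -> trow T k = i.+1 by move/(subsetP Yrow); rewrite inE => /eqP.
exists (X :|: Y); split.
- rewrite cardsU (_ : X :&: Y = set0) ?cards0 ?subn0 ?cardX ?cardY.
    by rewrite subnK // (leq_trans yle) // (leq_trans (nth_sorted_geq i la_sorted)).
  apply/setP => k; rewrite !inE; apply/negP => /andP[/inX + /inY].
  by move=> ->; lia.
- by apply/shufflesP; split=> // k; rewrite inE => /orP[/inX|/inY]; [left|right].
rewrite -cardY; apply: eq_card => k; rewrite !inE.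
have [/inX kX|_] /= := boolP (k \in X).
  rewrite kX ltn_eqF //; apply/esym/negP => /inY; rewrite kX; lia.
by have [/inY->|//] := boolP (k \in Y); rewrite eqxx.
Qed.

Lemma lowered_bounds (T : tabloid n la) i (Z : {set 'I_n}) : #|Z| = (nth 0 la i).+1 ->
  shuffles T i Z T -> 0 < #|lowered T i Z| <= nth 0 la i.+1.
Proof.
move=> cardZ /shufflesP[ZT _]; apply/andP; split; last first.
  rewrite -(card_trow T); apply/subset_leq_card/subsetP => k.
  by rewrite !inE => /andP[].
have := card_row_on i ZT; rewrite ltn_eqF // eqxx -/(lowered T i Z) cardZ.
have := card_trow_split T Z i; lia.
Qed.

Lemma exists_tabloid : exists T : tabloid n la, True.
Proof.
have castn : n = #|{: box la}| by rewrite (card_box la_n).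
pose f := [ffun k : 'I_n => enum_val (cast_ord castn k)].
have fT : [forall b, #|[set k | f k == b]| == 1].
  apply/forallP => b.
  rewrite (_ : [set _ | _] = [set cast_ord (esym castn) (enum_rank b)]).
    by rewrite cards1.
  apply/setP => k; rewrite !inE ffunE.
  apply/eqP/eqP => [<-|->]; first by rewrite enum_valK cast_ordK.
  by rewrite cast_ordKV enum_rankK.
by exists (tabloid_of (Sub f fT)).
Qed.

(** The Specht module is the set of solutions of a system of linear equations over
    the integers, the vanishing of the Garnir sums. *)
Lemma specht_pure (x : permmod n la) N : 0 < N ->
  (x *+ N)%R \in @in_specht n la -> x \in @in_specht n la.
Proof.
move=> N0 NxS; have [|y yS xy] := @straightening n la la_n 0 x.
  move=> T i Z cardZ _; rewrite dvd0z.
  have := garnir_sum_specht la_n T NxS cardZ; rewrite /garnir_sum.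
  under eq_bigr do rewrite ffunMnE.
  rewrite sumrMnl => /eqP; rewrite Num.Theory.mulrn_eq0 => /orP[/eqP N00|//].
  by rewrite N00 in N0.
suff -> : x = y by [].
by apply/ffunP => T; apply/eqP; rewrite -subr_eq0 -dvd0z.
Qed.

(** An element of the Specht module that is congruent modulo p to a multiple of the
    sum of all tabloids still has vanishing Garnir sums, so the multiple or all the
    binomial coefficients vanish modulo p. Conversely, when these coefficients
    vanish modulo p, straightening produces an element of the Specht module that is
    congruent to the sum of all tabloids. *)
Lemma specht_const_modP (p : nat) : prime p -> garnir_bin p <->
  exists2 m : permmod n la, m \in @in_specht n la &
    (exists T, ~~ (p%:Z %| m T)%Z) /\ forall T T', (p%:Z %| (m T' - m T)%R)%Z.
Proof.
move=> p_pr; split=> [bin|[m mS [[T pT] mp]] i y yb].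
  have [|m mS m1] := @straightening n la la_n p%:Z [ffun=> 1%R].
    move=> T i Z cardZ shT.
    rewrite garnir_sum_const_mod // => [|T']; last by rewrite !ffunE subrr dvdz0.
    by rewrite ffunE cardZ natz dvdzE; apply: bin; apply: lowered_bounds.
  exists m => //; have m1' T : (p%:Z %| (1 - m T)%R)%Z by have := m1 T; rewrite !ffunE.
  split=> [|T T'].
    have [T _] := exists_tabloid; exists T; apply/negP => pm.
    have := rpredD (m1' T) pm; rewrite subrK dvdz1.
    by case: p p_pr {bin m1 m1' pm} => [|[]].
  by have := rpredB (m1' T) (m1' T'); rewrite opprB addrC addrA subrK.
have [Z [cardZ shT <-]] := exists_shuffle T yb.
have := garnir_sum_const_mod shT (mp T); rewrite (garnir_sum_specht la_n _ mS) // dvdz0.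
rewrite cardZ -mulr_natr natz => /esym.
by rewrite dvdzE abszM Euclid_dvdM //; rewrite dvdzE in pT; rewrite (negPf pT).
Qed.

(** For i = 0 and y = 1 the Garnir sum of a constant c is the nonzero multiple
    (la_0 + 1) c. *)
Lemma specht_invariant0 (m : permmod n la) : 1 < size la ->
  m \in @in_specht n la -> (forall T T', m T' = m T) -> m = 0%R.
Proof.
move=> sz mS mc; apply/ffunP => T; rewrite ffunE.
have [|Z [cardZ shT lo]] := @exists_shuffle T 0 1.
  rewrite /= lt0n; have /and3P[_ la0 _] := la_n.
  by apply: contra la0 => /eqP <-; apply: mem_nth.
have m0 T' : (0 %| (m T' - m T)%R)%Z by rewrite (mc T) subrr dvdz0.
have := garnir_sum_const_mod shT m0.
rewrite (garnir_sum_specht la_n _ mS) // dvdz0 dvd0z lo bin1 cardZ Num.Theory.mulrn_eq0.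
by move/esym/eqP.
Qed.

End Constants.

(** * First cohomology of a finite group *)

Section Cohomology.
Variables (gT : finGroupType) (M : gmodule gT).
Local Open Scope ring_scope.

Definition cohom_class (c : cocycle1 M) : H1 M :=
  (\pi_(Quotient.quot (@is_coboundary1 gT M)) c)%qT.

Lemma cohom_class_surj (h : H1 M) : exists c, h = cohom_class c.
Proof. by exists (generic_quotient.repr h); rewrite /cohom_class reprK. Qed.

Lemma eq_cohom_class c c' :
  cohom_class c = cohom_class c' <-> c - c' \in @is_coboundary1 gT M.
Proof.
rewrite Quotient.idealrBE; split; first by move=> eqc; apply/eqP.
by move/eqP.
Qed.

Lemma cohom_class_eq0 c :
  cohom_class c = 0 <-> exists m : M, forall g, val c g = gact M m g - m.
Proof.
have -> : 0 = cohom_class 0 by rewrite /cohom_class raddf0.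
by rewrite eq_cohom_class subr0; split=> /coboundary1P.
Qed.

Lemma cohom_classMn c k : cohom_class (c *+ k) = cohom_class c *+ k.
Proof. by rewrite /cohom_class raddfMn. Qed.

Lemma valMn_cocycle (c : cocycle1 M) k g : val (c *+ k) g = val c g *+ k.
Proof. by rewrite raddfMn ffunMnE. Qed.

Lemma gactB g (u v : M) : gact M (u - v) g = gact M u g - gact M v g.
Proof. by rewrite gactD gactN. Qed.

Lemma gactA g h (u : M) : gact M u (g * h)%g = gact M (gact M u g) h.
Proof. by case: (gact M) => to [_ toM] /=; rewrite toM ?inE. Qed.

Lemma gactMn g (u : M) k : gact M (u *+ k) g = gact M u g *+ k.
Proof. by elim: k => [|k IHk]; rewrite ?gact0 // !mulrSr gactD IHk. Qed.

Lemma cocycle_of_fun (f : gT -> M) :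
  (forall g h, f (g * h)%g = gact M (f g) h + f h) ->
  exists c : cocycle1 M, val c =1 f.
Proof.
move=> fM; have fC : [ffun g => f g] \in @is_cocycle1 gT M.
  by apply/cocycle1P => g h; rewrite !ffunE.
by exists (Sub [ffun g => f g] fC) => g; rewrite SubK ffunE.
Qed.

Definition torsion_free (A : zmodType) :=
  forall k (a : A), (0 < k)%N -> a *+ k = 0 -> a = 0.

Hypothesis M_tf : torsion_free M.

Lemma mulrnI_tf k : (0 < k)%N -> injective (fun a : M => a *+ k).
Proof.
move=> k0 a b /= eqab; apply/eqP; rewrite -subr_eq0; apply/eqP.
by apply: M_tf k0 _; rewrite mulrnBl eqab subrr.
Qed.

(** If k kills the class of a cocycle c, then k c is the coboundary of an element
    that is invariant modulo k M, and c is recovered from it by dividing by k.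
    This is exactness of H^0(M) -> H^0(M/kM) -> H^1(M) -> H^1(M) in the middle
    terms, with elements of M/kM replaced by representatives. *)
Lemma H1_torsionP (k : nat) : (0 < k)%N ->
  (exists2 h : H1 M, h != 0 & h *+ k = 0) <->
  (exists2 m : M, (forall g, exists d, gact M m g - m = d *+ k) &
     forall m0 d, (forall g, gact M m0 g = m0) -> m != m0 + d *+ k).
Proof.
move=> k0; split=> [[h h0 hk]|[m mk m_lift]].
  have [c def_h] := cohom_class_surj h.
  have /cohom_class_eq0[m cm] : cohom_class (c *+ k) = 0.
    by rewrite cohom_classMn -def_h.
  exists m => [g|m0 d m0G]; first by exists (val c g); rewrite -cm valMn_cocycle.
  apply: contraNneq h0 => def_m; apply/eqP; rewrite def_h.
  apply/cohom_class_eq0; exists d => g; apply: (mulrnI_tf k0).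
  rewrite -valMn_cocycle cm def_m gactD m0G gactMn mulrnBl opprD addrACA.
  by rewrite subrr add0r.
have [f fE] := choice mk.
have [g h|c cf] := @cocycle_of_fun f.
  apply: (mulrnI_tf k0); rewrite mulrnDl -gactMn -!fE gactB gactA.
  by rewrite addrA subrK.
exists (cohom_class c).
  apply/eqP => /cohom_class_eq0[d cd]; have := m_lift (m - d *+ k) d.
  rewrite subrK eqxx => /(_ _)/negP[] // g; rewrite gactB gactMn.
  have := fE g; rewrite -cf cd mulrnBl => /eqP; rewrite subr_eq => /eqP->.
  by rewrite [LHS]addrC !addrA addNr add0r addrC.
rewrite -cohom_classMn; apply/cohom_class_eq0; exists m => g.
by rewrite valMn_cocycle cf fE.
Qed.

(** The averaging argument: the sum of all values of a cocycle c has coboundary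
    - #|gT| c. *)
Lemma H1_exponent (c : cocycle1 M) : cohom_class c *+ #|gT| = 0.
Proof.
rewrite -cohom_classMn; apply/cohom_class_eq0.
exists (- \sum_g val c g) => h; rewrite valMn_cocycle gactN.
have /cocycle1P cM := valP c.
have actS : gact M (\sum_g val c g) h = \sum_g gact M (val c g) h.
  by apply: (big_morph (fun u => gact M u h)) => [u v|]; rewrite ?gactD ?gact0.
have sumE : \sum_g val c g = \sum_g gact M (val c g) h + val c h *+ #|gT|.
  rewrite (reindex_inj (mulIg h)) /=; under eq_bigr do rewrite cM.
  by rewrite big_split /= sumr_const.
by rewrite actS opprK sumE addKr.
Qed.

(** Cocycles that agree modulo #|gT| are cohomologous, so that H^1 is finite as
    soon as M / #|gT| M is. *)
Lemma H1_finite (F : finType) (r : M -> F) :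
    (forall u v, r u = r v -> exists d, u - v = d *+ #|gT|) ->
  finite_set [set: H1 M].
Proof.
move=> rP; have G0 : (0 < #|gT|)%N by apply/card_gt0P; exists 1%g.
pose R (c : cocycle1 M) : {ffun gT -> F} := [ffun g => r (val c g)].
have RP c c' : R c = R c' -> cohom_class c = cohom_class c'.
  move=> eqR; apply/eq_cohom_class.
  have cc' g : exists d, val c g - val c' g = d *+ #|gT|.
    by apply: rP; move/ffunP/(_ g): eqR; rewrite !ffunE.
  have [d cd] := choice cc'.
  have [g h|e ed] := @cocycle_of_fun d.
    have /cocycle1P cM := valP c; have /cocycle1P c'M := valP c'.
    apply: (mulrnI_tf G0); rewrite mulrnDl -gactMn -!cd cM c'M gactB.
    by rewrite opprD addrACA.
  have -> : c - c' = e *+ #|gT|.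
    by apply/val_inj/ffunP => g; rewrite valMn_cocycle ed -cd GRing.valB !ffunE.
  by rewrite -[_ *+ _]subr0; apply/eq_cohom_class; rewrite cohom_classMn H1_exponent
    /cohom_class raddf0.
pose s (y : {ffun gT -> F}) : H1 M :=
  if pselect (exists c, R c = y) is left ex then cohom_class (projT1 (cid ex)) else 0.
have -> : [set: H1 M]%classic = (s @` [set: {ffun gT -> F}])%classic.
  apply/seteqP; split=> // h _; have [c ->] := cohom_class_surj h.
  exists (R c) => //; rewrite /s; case: pselect => [ex|[]]; last by exists c.
  by case: (cid ex) => c' /= /RP.
exact/finite_image/finite_finset.
Qed.

End Cohomology.

(** * The theorem of Cauchy for finite abelian groups *)

Section Cauchy.
Variables (A : zmodType) (N : nat) (f : A -> 'I_N) (g : 'I_N -> A).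
Hypotheses (fK : cancel f g) (gK : cancel g f).

(** This copy of 'I_N carries the group law of A, which makes the theorems of Cauchy
    and Lagrange for finite groups applicable to A. *)
Definition transport : Type := 'I_N.
HB.instance Definition _ := Finite.on transport.

Definition tmul (x y : transport) : transport := f (g x + g y)%R.
Definition tone : transport := f 0%R.
Definition tinv (x : transport) : transport := f (- g x)%R.

Lemma tmulA : associative tmul.
Proof. by move=> x y z; rewrite /tmul !fK addrA. Qed.
Lemma tmul1 : left_id tone tmul.
Proof. by move=> x; rewrite /tmul /tone fK add0r gK. Qed.
Lemma tmulV : left_inverse tone tinv tmul.
Proof. by move=> x; rewrite /tmul /tone /tinv fK addNr. Qed.

HB.instance Definition _ := Finite_isGroup.Build transport tmulA tmul1 tmulV.

Lemma g_expg (x : transport) k : g (x ^+ k)%g = (g x *+ k)%R.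
Proof.
elim: k => [|k IHk]; first by rewrite expg0 mulr0n; exact: fK.
by rewrite expgS mulrS -IHk; exact: fK.
Qed.

Lemma dvd_card_torsion p : prime p ->
  p %| N <-> exists2 a : A, (a != 0)%R & (a *+ p = 0)%R.
Proof.
have g1 : g (1%g : transport) = 0%R by exact: fK.
have g_inj : injective g := can_inj gK.
have cardN : #|[set: transport]| = N by rewrite cardsT card_ord.
move=> p_pr; split=> [pN|[a a0 pa]].
  have [|x _ ox] := @Cauchy transport p [set: transport]%G p_pr; first by rewrite cardN.
  exists (g x); last by rewrite -g_expg -ox expg_order.
  apply: contraTneq (prime_gt1 p_pr) => gx0.
  by rewrite -ox (_ : x = 1%g) ?order1 //; apply: g_inj; rewrite gx0.
rewrite -cardN; have : #[f a : transport]%g %| p.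
  by rewrite order_dvdn; apply/eqP/g_inj; rewrite g_expg fK pa.
case/primeP: p_pr => _ p_div /p_div /orP[|/eqP <-]; last by rewrite order_dvdG ?inE.
rewrite order_eq1 => /eqP fa1; move: a0.
by rewrite -(fK a) fa1 g1 eqxx.
Qed.

End Cauchy.

(** One direction is the theorem of Cauchy, the other that of Lagrange. *)
Lemma dvd_cardP p (A : zmodType) : prime p -> finite_set [set: A] ->
  dvd_card p A <-> exists2 a : A, (a != 0)%R & (a *+ p = 0)%R.
Proof.
move=> p_pr A_fin.
have cardP N : ([set: A] #= `I_N)%card -> p %| N <->
    exists2 a : A, (a != 0)%R & (a *+ p = 0)%R.
  move=> /card_set_bijP[f [f_lt f_inj f_surj]].
  pose f' a : 'I_N := Ordinal (f_lt a I : f a < N).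
  have f'_surj i : exists a, f' a = i.
    by have [a _ ai] := f_surj i (ltn_ord i); exists a; apply: val_inj.
  have [g gE] := choice f'_surj.
  apply: (dvd_card_torsion (f := f') (g := g)) => // a.
  apply: f_inj; [exact: mem_set | exact: mem_set |].
  by have /= := congr1 val (gE (f' a)).
split=> [[N AN pN]|ptors]; first exact/(cardP N).
have [N AN] := A_fin; exists N => //; exact/(cardP N).
Qed.

(** * The cohomology of Specht modules *)

Section SpechtCohomology.
Variables (n : nat) (la : seq nat).
Hypothesis la_n : is_partition n la.

Lemma specht_torsion_free : torsion_free (specht n la).
Proof.
move=> k x k0 kx; apply/val_inj/ffunP => T; rewrite GRing.val0 ffunE.
have /(congr1 val)/ffunP/(_ T) := kx.
rewrite GRing.val0 raddfMn ffunMnE ffunE => /eqP.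
by rewrite Num.Theory.mulrn_eq0 => /orP[/eqP k00|/eqP//]; rewrite k00 in k0.
Qed.

Lemma specht_divP N (x : specht n la) : 0 < N ->
  (forall T, (N%:Z %| val x T)%Z) <-> exists d, x = (d *+ N)%R.
Proof.
move=> N0; split=> [xN|[d ->] T]; last first.
  by rewrite raddfMn ffunMnE -mulr_natr natz dvdz_mull.
pose d : permmod n la := [ffun T => (val x T %/ N%:Z)%Z].
have dN : (d *+ N = val x)%R.
  by apply/ffunP => T; rewrite ffunMnE ffunE -mulr_natr natz divzK.
have dS : d \in @in_specht n la.
  by apply: (specht_pure la_n N0); rewrite dN; apply: valP.
by exists (Sub d dS); apply: val_inj; rewrite raddfMn /= dN.
Qed.

Lemma specht_H1_finite : finite_set [set: H1 (specht n la)].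
Proof.
pose F := {ffun tabloid n la -> 'I_#|'S_n|.-1.+1}.
have N0 : 0 < #|'S_n| by apply/card_gt0P; exists 1%g.
pose r (x : specht n la) : F := [ffun T => inord (absz (val x T %% #|'S_n|%:Z)%Z)].
apply: (H1_finite specht_torsion_free (r := r)) => u v eqr.
apply/specht_divP => // T; rewrite GRing.valB !ffunE.
move/ffunP/(_ T): eqr; rewrite !ffunE => /(congr1 val) /=.
have lt (z : int) : absz (z %% #|'S_n|%:Z)%Z < #|'S_n|.-1.+1.
  by rewrite prednK //; have := ltz_pmod z (_ : 0 < #|'S_n|%:Z)%R; lia.
rewrite !inordK // -eqz_mod_dvd => /(congr1 Posz).
by rewrite !gez0_abs ?modz_ge0 -?lt0n // => ->.
Qed.

Lemma specht_invariantE (m : specht n la) :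
  (forall g, gact (specht n la) m g = m) -> forall T T', val m T' = val m T.
Proof.
move=> mG T T'; have [s ->] := tabloid_act_trans T T'.
by have /(congr1 val)/ffunP/(_ T) := mG (s^-1)%g; rewrite /= ffunE invgK.
Qed.

Lemma specht_H1_torsionP p : prime p -> la <> one_row n ->
  (exists2 h : H1 (specht n la), (h != 0)%R & (h *+ p = 0)%R) <-> garnir_bin la p.
Proof.
move=> p_pr la_row.
have la2 : 1 < size la.
  move: la_row; have /and3P[_ la0 /eqP <-] := la_n.
  case: la la0 => [|a [|//]] //=; rewrite inE addn0.
  by case: a.
rewrite (H1_torsionP specht_torsion_free (prime_gt0 p_pr)).
rewrite (specht_const_modP la_n p_pr).
split=> [[m mp m_lift]|[m mS [[T pT] mp]]].
  exists (val m); first exact: valP.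
  split.
    apply: contrapT => pm; have /specht_divP : forall T, (p%:Z %| val m T)%Z.
      by move=> T; apply/negPn/negP => pT; apply: pm; exists T.
    move=> /(_ (prime_gt0 p_pr))[d def_m].
    by have /eqP[] := m_lift 0%R d (gact0 _); rewrite add0r.
  move=> T T'; have [s ->] := tabloid_act_trans T T'.
  have [d /(congr1 val)/ffunP/(_ T)] := mp (s^-1)%g.
  rewrite raddfMn GRing.valB /= !ffunE invgK ffunMnE => ->.
  by rewrite -mulr_natr natz dvdz_mull.
exists (Sub m mS : specht n la) => [g|m0 d m0G].
  apply/specht_divP; first exact: prime_gt0.
  by move=> T'; rewrite GRing.valB /= !ffunE.
have m00 : m0 = 0%R.
  apply: val_inj; rewrite GRing.val0; apply: (specht_invariant0 la_n la2).
    exact: valP.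
  exact: specht_invariantE.
apply: contraNneq pT => def_m.
have/specht_divP : exists d, (Sub m mS : specht n la) = (d *+ p)%R.
  by exists d; rewrite def_m m00 add0r.
by move/(_ (prime_gt0 p_pr) T).
Qed.

(** There is only one tabloid, so the action is trivial, a coboundary is 0, and a
    cocycle of finite order is 0 because the module is torsion free. *)
Lemma one_row_H1_torsion p (h : H1 (specht n la)) : prime p -> la = one_row n ->
  (h *+ p = 0)%R -> h = 0%R.
Proof.
move=> p_pr def_la; have [c ->] := cohom_class_surj h.
rewrite -cohom_classMn => /cohom_class_eq0[m cm]; apply/cohom_class_eq0.
exists 0%R => g; rewrite gact0 subrr; apply: specht_torsion_free (prime_gt0 p_pr) _.
rewrite -valMn_cocycle cm; apply/eqP; rewrite subr_eq0; apply/eqP/val_inj/ffunP => T.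
rewrite /= ffunE; congr (val m _); apply: trow_inj => k.
have row0 (T' : tabloid n la) : trow T' k = 0.
  have la1 : size la <= 1 by rewrite def_la; case: (n).
  by have := leq_trans (trow_lt T' k) la1; case: (trow T' k).
by rewrite !row0.
Qed.

End SpechtCohomology.

Lemma eqz_modN1 (a q : nat) : (a%:Z = -1 %[mod q%:Z])%Z <-> q %| a.+1.
Proof.
have -> : (q %| a.+1) = (a%:Z == -1 %[mod q%:Z])%Z.
  by rewrite eqz_mod_dvd opprK dvdzE addrC.
exact: rwP eqP.
Qed.

Theorem corollary1p2 (p n : nat) (la : seq nat)
    (p_prime : prime p) (la_n : is_partition n la) :
  C1 p la <->
  la <> one_row n /\
  (forall i : nat, i < size la ->
     ((nth 0%N la i)%:Z
        = -1 %[mod (p ^ minexp (nth 0%N la i.+1) p_prime)%N%:Z])%Z).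
Proof.
have cond : garnir_bin la p <-> (forall i : nat, i < size la ->
     ((nth 0%N la i)%:Z
        = -1 %[mod (p ^ minexp (nth 0%N la i.+1) p_prime)%N%:Z])%Z).
  have binP i : p ^ minexp (nth 0 la i.+1) p_prime %| (nth 0 la i).+1 <->
      forall y, 0 < y <= nth 0 la i.+1 -> p %| 'C((nth 0 la i).+1, y).
    by rewrite /minexp; case: ex_minnP => z; apply: expn_dvd_binP.
  split=> [bin i _|mod i y yb]; first by apply/eqz_modN1/binP/bin.
  have [ilt|ige] := ltnP i (size la).
    by apply: (iffLR (binP i)) yb; apply/eqz_modN1/mod.
  by move: yb; rewrite nth_default 1?leqW //; lia.
have C1P : C1 p la <-> exists2 h : H1 (specht n la), (h != 0)%R & (h *+ p = 0)%R.
  rewrite -(dvd_cardP p_prime (specht_H1_finite la_n)).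
  split=> [[n' _ [la_n' pH]]|pH]; last by exists n.
  suff -> : n = n' by [].
  by have /and3P[_ _ /eqP <-] := la_n; have /and3P[_ _ /eqP <-] := la_n'.
rewrite C1P -cond; split=> [tors|[la_row bin]]; last first.
  exact/(specht_H1_torsionP la_n p_prime la_row).
have la_row : la <> one_row n.
  by case: tors => h h0 ph la_row; case/eqP: h0; apply: one_row_H1_torsion ph.
by split=> //; apply/(specht_H1_torsionP la_n p_prime la_row).
Qed.
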